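(* Let $p\ge2$ be an integer. If a finite projective plane of order $p-1$ exists, then the natural $p$-matchoid LP has integrality gap (exactly) $p-1+\frac1p$. That is, the supremum, over all $p$-matchoids $\mathcal{L}$ with ground set $E$ and all weight vectors $w\in\mathbb{R}_{\ge0}^E$ for which $\max\{w(I):I\in\mathcal{F}_{\mathcal{L}}\}>0$, of the ratio $$\frac{\max\{w\cdot x:x\in P_{\mathcal{L}}\}}{\max\{w(I):I\in\mathcal{F}_{\mathcal{L}}\}}$$ equals $p-1+\frac1p$, where $w(I)=\sum_{e\in I}w_e$.
   Context: Let $\mathcal{L}=\{M_j=(E_j,\mathcal{I}_j):j=1,\ldots,m\}$ be a finite collection of matroids on possibly overlapping finite sets $E_j$ (the local ground sets), and let $E=\bigcup_{j=1}^mE_j$. The collection is a $p$-matchoid if every element of $E$ belongs to at most $p$ of the sets $E_j$. Its feasible sets are $\mathcal{F}_{\mathcal{L}}=\{I\subseteq E: I\cap E_j\in\mathcal{I}_j\ \text{for every } j\}$. For a matroid $M$ on $E'$ with rank function $r_M$, its independent set polytope is $P(M)=\{y\in\mathbb{R}_{\ge0}^{E'}:\sum_{e\in S}y_e\le r_M(S)\ \forall S\subseteq E'\}$, and the natural LP of the $p$-matchoid maximizes $w\cdot x$ over $P_{\mathcal{L}}=\{x\in[0,1]^E: x|_{E_j}\in P(M_j)\ \text{for every } j\}$. The integrality gap is the worst-case ratio between the LP optimum and the maximum weight of a set in $\mathcal{F}_{\mathcal{L}}$. A projective plane of order $p-1$ has $p^2-p+1$ points and the same number of lines, every point lies on $p$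 lines, every line contains $p$ points, and any two distinct lines meet in exactly one point (and any two distinct points lie on exactly one common line). *)

(* Defs.v *)
From HB Require Import structures.
From mathcomp Require Import all_boot all_order all_algebra.

Set Implicit Arguments.
Unset Strict Implicit.
Unset Printing Implicit Defensive.

Import Order.TTheory GRing.Theory Num.Theory.

Local Open Scope ring_scope.

(* A matroid on a subset [ground] of the ambient type E, so that several
   matroids on overlapping ground sets can share the same E. *)
Record matroid (E : finType) := Matroid {
  ground : {set E};
  indep : {set {set E}};
  indep_ground : forall I : {set E}, I \in indep -> I \subset ground;
  indep0 : set0 \in indep;
  indep_sub : forall I J : {set E}, J \in indep -> I \subset J -> I \in indep;
  indep_aug : forall I J : {set E}, I \in indep -> J \in indep ->
    (#|I| < #|J|)%N -> exists2 e, e \in J :\: I & e |: I \in indep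
}.

Definition rank (E : finType) (M : matroid E) (S : {set E}) : nat :=
  \max_(I in indep M | I \subset S) #|I|.

Definition is_matchoid (p : nat) (E : finType) (m : nat)
    (M : 'I_m -> matroid E) : Prop :=
  \bigcup_j ground (M j) = [set: E] /\
  (forall e : E, (#|[set j | e \in ground (M j)]| <= p)%N).

Definition feasible (E : finType) (m : nat) (M : 'I_m -> matroid E) :
    {set {set E}} :=
  [set I : {set E} | [forall j, I :&: ground (M j) \in indep (M j)]].

(* A plane with point set P, line set L and incidence relation inc; the
   triangle (n = 1) counts as a plane. *)
Definition projective_plane (n : nat) (P L : finType)
    (inc : P -> L -> bool) : Prop :=
  [/\ #|P| = (n ^ 2 + n + 1)%N /\ #|L| = (n ^ 2 + n + 1)%N,
      forall a : P, #|[set l | inc a l]| = n.+1,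
      forall l : L, #|[set a | inc a l]| = n.+1,
      forall l1 l2 : L, l1 != l2 -> #|[set a | inc a l1 && inc a l2]| = 1%N
    & forall a1 a2 : P, a1 != a2 -> #|[set l | inc a1 l && inc a2 l]| = 1%N].

(* Imported only here: its [set0], [subset], etc. shadow those of finset. *)
From mathcomp Require Import all_classical all_reals all_analysis.
Import numFieldNormedType.Exports.
Local Open Scope classical_set_scope.
Local Open Scope ring_scope.

(* The cylinder { x in R^E | x restricted to (ground M) lies in P(M) } over the
   independent set polytope P(M), which itself lives in R^(ground M). *)
Definition in_polytope (R : realType) (E : finType) (M : matroid E)
    (x : E -> R) : Prop :=
  (forall e, e \in ground M -> 0 <= x e) /\
  (forall S : {set E}, S \subset ground M ->
     \sum_(e in S) x e <= (rank M S)%:R).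

Definition lp_polytope (R : realType) (E : finType) (m : nat)
    (M : 'I_m -> matroid E) : set (E -> R) :=
  [set x | (forall e, 0 <= x e <= 1) /\ (forall j, in_polytope (M j) x)].
Arguments lp_polytope R [E m] M _.

(* This supremum is a maximum: see [lp_opt_attained]. *)
Definition lp_opt (R : realType) (E : finType) (m : nat)
    (M : 'I_m -> matroid E) (w : E -> R) : R :=
  sup [set \sum_e w e * x e | x in lp_polytope R M].

(* For w >= 0 the default value 0 is harmless, as set0 is feasible with
   weight 0. *)
Definition int_opt (R : realType) (E : finType) (m : nat)
    (M : 'I_m -> matroid E) (w : E -> R) : R :=
  \big[Num.max/0]_(I in feasible M) \sum_(e in I) w e.

Definition gap_ratios (R : realType) (p : nat) : set R :=
  [set r | exists (E : finType) (m : nat) (M : 'I_m -> matroid E) (w : E -> R),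
     [/\ is_matchoid p M, forall e, 0 <= w e, 0 < int_opt M w
       & r = lp_opt M w / int_opt M w]].
Arguments gap_ratios R p _ : clear implicits.

Definition integrality_gap (R : realType) (p : nat) : \bar R :=
  ereal_sup [set r%:E | r in gap_ratios R p].

Section Attained.
Import ArrowAsProduct.

Lemma linear_form_continuous (R : realType) (E : finType) (w : E -> R)
    (P : pred E) : continuous (fun x : E -> R => \sum_(e | P e) w e * x e).
Proof.
have pc e : continuous (fun x : E -> R => w e * x e).
  move=> x; apply: (@cvgM R _ (nbhs x) _ (fun=> w e) (fun x : E -> R => x e)).
    exact: cvg_cst.
  exact: (@proj_continuous E (fun=> R) e x).
elim: (index_enum E) => [|e r IHr].
  by rewrite (_ : (fun x => _) = fun=> 0); [exact: cst_continuous|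
    apply/funext => x; rewrite big_nil].
case Pe: (P e).
  rewrite (_ : (fun x => _) = fun x : E -> R =>
      w e * x e + \sum_(e <- r | P e) w e * x e); last first.
    by apply/funext => x; rewrite big_cons Pe.
  by move=> x; apply: (@cvgD R _ _ (nbhs x)); [exact: pc|exact: IHr].
rewrite (_ : (fun x => _) = fun x : E -> R =>
    \sum_(e <- r | P e) w e * x e) //.
by apply/funext => x; rewrite big_cons Pe.
Qed.

Lemma lp_polytope_compact (R : realType) (E : finType) (m : nat)
    (M : 'I_m -> matroid E) : compact (lp_polytope R M).
Proof.
pose A : set (E -> R) := [set x | forall e, `[0, 1]%classic (x e)].
pose B : set (E -> R) := \bigcap_(j in [set: 'I_m])
  \bigcap_(S in [set S : {set E} | S \subset ground (M j)])
  [set x : E -> R | \sum_(e in S) x e <= (rank (M j) S)%:R].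
have -> : lp_polytope R M = A `&` B.
  apply/seteqP; split=> x.
    move=> [x01 Mx]; split=> [e|j _ S /= Sj]; first by rewrite /= in_itv /= x01.
    exact: (Mx j).2.
  move=> [x01 Bx]; have {}x01 e : 0 <= x e <= 1.
    by have := x01 e; rewrite /= in_itv.
  split=> // j; split=> [e _|S Sj]; first by case/andP: (x01 e).
  exact: Bx.
apply: compact_closedI.
  by apply: (@tychonoff E (fun=> R) (fun=> `[0, 1]%classic)) => e;
    exact: segment_compact.
apply: closed_bigI => j _; apply: closed_bigI => S _.
have -> : [set x : E -> R | \sum_(e in S) x e <= (rank (M j) S)%:R] =
    (fun x : E -> R => \sum_(e in S) 1 * x e) @^-1`
      [set y | y <= (rank (M j) S)%:R].
  apply/funext => x /=; congr (_ <= _).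
  by apply: eq_bigr => e _; rewrite mul1r.
apply: preimage_closed; last exact: closed_le.
by move=> x _; exact: linear_form_continuous.
Qed.

Lemma lp_opt_attained (R : realType) (E : finType) (m : nat)
    (M : 'I_m -> matroid E) (w : E -> R) :
  exists2 x, lp_polytope R M x &
    \sum_e w e * x e = lp_opt M w /\
    forall y, lp_polytope R M y -> \sum_e w e * y e <= lp_opt M w.
Proof.
have P0 : lp_polytope R M !=set0.
  exists (fun=> 0); split=> [e|j]; first by rewrite lexx ler01.
  by split=> // S _; rewrite big1.
have [|x Px xmax] := @compact_EVT_max _ R (fun x => \sum_e w e * x e) _ P0
  (@lp_polytope_compact R E m M).
  by apply: continuous_subspaceT; exact: linear_form_continuous.
exists x; first exact: set_mem.
have -> : lp_opt M w = \sum_e w e * x e.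
  apply/eqP; rewrite eq_le; apply/andP; split.
    apply: ge_sup; first exact: image_nonempty P0.
    by move=> _ [y Py <-]; apply: xmax; exact: mem_set.
  apply: ub_le_sup; last by exists x => //; exact: set_mem.
  by exists (\sum_e w e * x e) => _ [y Py <-]; apply: xmax; exact: mem_set.
by split=> // y Py; apply: xmax; exact: mem_set.
Qed.

End Attained.

(* Main.v *)
Require Import Defs.
From mathcomp Require Import all_boot all_order all_algebra ring lra.

Set Implicit Arguments.
Unset Strict Implicit.
Unset Printing Implicit Defensive.

Import Order.TTheory GRing.Theory Num.Theory.

Local Open Scope ring_scope.

(** Let [a = p - 1 + 1/p].

    Upper bound.  Every point [x] of the LP is to be rounded to a feasible set [I]
    with [w(I) >= w.x / a].  The elements are made private one after the other: a
    private element is replaced by independent copies, one in each matroid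
    containing it, and the copy in [M j] is paid [s j e].  Let [F] be the set of
    elements that are not private yet.  The induction ([rounding]) finds [I]
    inside [F] and independent sets [K j] containing [I :&: ground (M j)] with
<<
    w(I) + sum_j s_j(K_j)
      >= (w.x + sum_j s_j.z_j) / a + (1 - 1/a) * sum_j max_weight(s_j),
>>
    where [z j] is the fractional point in the matroid [M j].  For [F] full and
    [s = 0] this is the claim.  For [F] empty it says that a point of a matroid
    polytope weighs at most as much as some independent set
    ([matroid_lp_le_max_weight]).

    For the step, take [f] in [F] with [x f >= 1/p].  In every matroid it has an
    entry price [t_j] ([entry_price]): forcing [f] into a set of maximum weight
    costs [t_j], and in any independent set [f] can be exchanged for something
    worth [t_j].  Let [W] be the excess of [w f] over the sum of these prices, and
    make [f] private with payment [t_j + W] in each of its [q] matroids.  If the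
    resulting sets [K j] all contain [f], then [f] joins [I], which gives up
    [q - 1] of the [q] surcharges [W].  Otherwise at most [q - 1] of the [K j]
    contain [f], and there it is exchanged, again losing [W] each time.  The right
    hand side has grown by at least that much, because [q <= p] and
    [x f >= 1/p] ([privatise_balance]).

    Such an [f] exists once the fractional point has been moved, without loss of
    value, until no more constraints can be made active ([sparse_point]); elements
    of value 0 are simply dropped.  In each matroid the tight sets form a lattice,
    which cuts their part of the support into atoms of positive integral mass
    ([atom_mass]).  An atom that contains a private copy puts no condition on the
    values on [F].  So if the point cannot be moved, there are at least as many
    atoms inside [F] as elements of [F]; each element is in at most [p] atoms, so
    some atom has at most [p] elements, hence one of value at least [1/p].

    Lower bound.  Let the elements be the lines of a projective plane of order
    [p - 1], and let every point allow at most one line through it.  Any two lines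
    meet, so a feasible set has at most one line, whereas the value [1/p] on each
    of the [p^2 - p + 1] lines is a point of the LP of total value [a]. *)

(** * Matroid rank *)

Section MatroidRank.
Variables (E : finType) (M : matroid E).
Implicit Types (I J S T B K : {set E}).

Lemma card_le_rank I S : I \in indep M -> I \subset S -> (#|I| <= rank M S)%N.
Proof. by move=> MI IS; apply: (@bigop.bigmax_sup _ I) => //; rewrite MI. Qed.

Lemma rank_le_card S : (rank M S <= #|S|)%N.
Proof. by apply/bigop.bigmax_leqP => I /andP[_ /subset_leq_card]. Qed.

Lemma rank_subset S T : S \subset T -> (rank M S <= rank M T)%N.
Proof.
move=> ST; apply/bigop.bigmax_leqP => I /andP[MI IS].
by apply: card_le_rank => //; exact: subset_trans IS ST.
Qed.

Lemma rank0 : rank M set0 = 0%N.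
Proof. by apply/eqP; rewrite -leqn0 -(cards0 E) rank_le_card. Qed.

Lemma rank_witness S : exists2 I, I \in indep M & I \subset S /\ #|I| = rank M S.
Proof.
have P0 : (set0 \in indep M) && (set0 \subset S) by rewrite indep0 sub0set.
rewrite /rank.
rewrite (bigop.bigmax_eq_arg (P := fun I => (I \in indep M) && (I \subset S)) _ P0).
by case: arg_maxnP => // I /andP[MI IS] _; exists I.
Qed.

Lemma indep_extend I S : I \in indep M -> I \subset S ->
  exists2 B, B \in indep M & [/\ I \subset B, B \subset S & #|B| = rank M S].
Proof.
move: {2}(rank M S - #|I|)%N (leqnn (rank M S - #|I|)) => n.
elim: n I => [|n IHn] I len MI IS; have leI := card_le_rank MI IS.
  by exists I => //; split=> //; apply/eqP; rewrite eqn_leq leI -subn_eq0 -leqn0.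
have [J MJ [JS cJ]] := rank_witness S.
have [ltI|geI] := ltnP #|I| #|J|; last first.
  by exists I => //; split=> //; apply/eqP; rewrite eqn_leq leI -cJ.
have [e /setDP[eJ eI] MeI] := indep_aug MI MJ ltI.
have [||B MB [IB BS cB]] := IHn (e |: I) _ MeI.
- by rewrite cardsU1 eI add1n subnS -ltnS (leq_trans _ len) // prednK // subn_gt0 -cJ.
- by rewrite subUset sub1set IS (subsetP JS).
by exists B => //; split=> //; apply: subset_trans IB; exact: subsetUr.
Qed.

(** A basis of [S :&: T], extended to a basis of [S :|: T], splits into
    independent subsets of [S] and [T] that overlap in the former. *)
Lemma rank_submod S T :
  (rank M (S :|: T) + rank M (S :&: T) <= rank M S + rank M T)%N.
Proof.
have [A MA [AST cA]] := rank_witness (S :&: T).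
have [|B MB [AB BST cB]] := @indep_extend A (S :|: T) MA.
  by apply: subset_trans AST _; rewrite subIset // subsetUl.
have BI X : B :&: X \in indep M by apply: indep_sub MB _; exact: subsetIl.
rewrite -cB -cA.
have BE : B = (B :&: S) :|: (B :&: T) by rewrite -setIUr; apply/esym/setIidPl.
apply: leq_trans (_ : (_ <= #|B :&: S| + #|B :&: T|)%N) _; last first.
  by rewrite leq_add // card_le_rank // subsetIr.
rewrite -(cardsUI (B :&: S)) -BE leq_add2l subset_leq_card //.
by rewrite -setIIr subsetI AB.
Qed.

End MatroidRank.

(** * Independent sets of maximum weight *)

Section MaxWeight.
Variables (R : realFieldType) (E : finType) (M : matroid E).
Implicit Types (s z : E -> R) (S B : {set E}).

Definition max_weight s : R :=
  \big[Num.max/0]_(B in indep M) \sum_(e in B) s e.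

Lemma le_max_weight s B : B \in indep M -> \sum_(e in B) s e <= max_weight s.
Proof. exact: le_bigmax_cond. Qed.

Lemma max_weight_attained s : (forall e, 0 <= s e) ->
  exists2 B, B \in indep M & \sum_(e in B) s e = max_weight s.
Proof.
move=> s0; rewrite /max_weight.
have [||B MB ->] := @Order.TotalTheory.eq_bigmax _ R {set E} 0 set0 (mem (indep M))
  (fun B => \sum_(e in B) s e).
- exact: indep0.
- by move=> B _; exact: sumr_ge0.
by exists B.
Qed.

(** The integrality of the matroid polytope.  With [d] the least positive
    weight, [s] is [d] on its support plus a weight of smaller support; a basis
    of the support extending an optimum for the latter is optimal for both. *)
Lemma matroid_lp_le_max_weight s z :
    (forall e, 0 <= s e) -> (forall e, 0 <= z e) ->
    (forall S : {set E}, \sum_(e in S) z e <= (rank M S)%:R) ->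
  \sum_e s e * z e <= max_weight s.
Proof.
move=> s0 z0 zr.
suff [B MB [_ leB]] : exists2 B, B \in indep M &
    B \subset [set e | s e != 0] /\ \sum_e s e * z e <= \sum_(e in B) s e.
  by apply: le_trans leB _; exact: le_max_weight.
have [n] := ubnP #|[set e | s e != 0]|; elim: n s s0 => // n IHn s s0.
set S := [set e | s e != 0] => ltn.
have [S0|[e0 Se0]] := set_0Vmem S.
  exists set0; first exact: indep0.
  rewrite sub0set big_set0 big1 // => e _.
  suff -> : s e = 0 by rewrite mul0r.
  apply/eqP; rewrite -[_ == _]negbK.
  by have := in_set0 e; rewrite -S0 inE => ->.
have [e1 Se1 mine1] : exists2 e1, e1 \in S & forall e, e \in S -> s e1 <= s e.
  by case: (@arg_minP _ R E e0 (mem S) s Se0) => e1 Se1 le1; exists e1.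
pose s' e := if e \in S then s e - s e1 else 0.
have sE e : s e = s' e + (e \in S)%:R * s e1.
  rewrite /s'; case: ifPn => [_|]; first by rewrite mul1r subrK.
  by rewrite inE negbK => /eqP ->; rewrite mul0r addr0.
have s'0 e : 0 <= s' e.
  by rewrite /s'; case: ifPn => // eS; rewrite subr_ge0 mine1.
have sub' : [set e | s' e != 0] \subset S :\ e1.
  apply/subsetP => e; rewrite in_set /s' in_setD1; case: ifPn => [eS|];
    last by rewrite eqxx.
  by rewrite andbT; apply: contraNneq => ->; rewrite subrr.
have [|B' MB' [B'S leB']] := IHn _ s'0.
  by apply: leq_ltn_trans (subset_leq_card sub') _; rewrite (cardsD1 e1 S) Se1 in ltn.
have [|B MB [B'B BS cB]] := @indep_extend _ M B' S MB'.
  by apply: subset_trans B'S (subset_trans sub' _); exact: subsetDl.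
exists B => //; split=> //.
have -> : \sum_e s e * z e = \sum_e s' e * z e + s e1 * \sum_(e in S) z e.
  rewrite mulr_sumr [X in _ = _ + X]big_mkcond -big_split /=.
  apply: eq_bigr => e _; rewrite sE mulrDl; congr (_ + _).
  by case: (e \in S); rewrite ?mul1r ?mul0r.
have -> : \sum_(e in B) s e = \sum_(e in B) s' e + s e1 * (rank M S)%:R.
  rewrite -cB -sum1_card natr_sum mulr_sumr -big_split /=.
  by apply: eq_bigr => e eB; rewrite sE (subsetP BS) // mul1r mulr1.
apply: lerD; last by rewrite ler_wpM2l.
apply: le_trans leB' _.
rewrite [leRHS](big_setID B') /= (setIidPr B'B) lerDl.
by apply: sumr_ge0.
Qed.

End MaxWeight.

Section EntryPrice.
Variables (R : realFieldType) (E : finType) (M : matroid E).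
Implicit Types (s z : E -> R) (S B K : {set E}).

(** The price [t] of [f] is what the maximum weight loses when [f], of weight 0,
    is forced into the independent set.  It is also what [f] can be sold for in
    any independent set [K]: were every swap of [f] for an element of weight at
    least [t] impossible, [f] could enter an optimal set at a cost below [t]. *)
Lemma entry_price s f : (forall e, 0 <= s e) -> s f = 0 -> [set f] \in indep M ->
  exists t : R, [/\ 0 <= t,
    exists2 B, B \in indep M & f \in B /\ max_weight M s <= t + \sum_(e in B) s e
    & forall K, K \in indep M -> f \in K -> exists2 K', K' \in indep M &
        K :\ f \subset K' /\ t + \sum_(e in K) s e <= \sum_(e in K') s e].
Proof.
move=> s0 sf0 Mf.
have sumD1 K : f \in K -> \sum_(e in K) s e = \sum_(e in K :\ f) s e.
  by move=> fK; rewrite (big_setD1 f) //= sf0 add0r.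
have [B MB optB] := max_weight_attained M s0.
have P0 : ([set f] \in indep M) && (f \in [set f]) by rewrite Mf set11.
have [Bf MBf [fBf maxBf]] : exists2 Bf, Bf \in indep M & f \in Bf /\
    forall K, K \in indep M -> f \in K -> \sum_(e in K) s e <= \sum_(e in Bf) s e.
  case: (@arg_maxP _ R {set E} [set f]
    (fun K => (K \in indep M) && (f \in K)) (fun K => \sum_(e in K) s e) P0).
  move=> Bf /andP[MBf fBf] maxBf; exists Bf => //; split=> // K MK fK.
  by apply: maxBf; rewrite MK fK.
set t := max_weight M s - \sum_(e in Bf) s e.
exists t; split; first by rewrite subr_ge0; exact: le_max_weight.
  by exists Bf => //; split=> //; rewrite /t subrK.
move=> K MK fK.
have [t_le0|t_gt0] := lerP t 0.
  exists K => //; split; first exact: subsetDl.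
  by rewrite gerDr.
have fB : f \notin B.
  by apply: contraTN t_gt0 => fB; rewrite /t -optB -leNgt subr_le0; exact: maxBf.
pose Bt := [set e in B | t <= s e].
have BtB : Bt \subset B by apply/subsetP => e; rewrite inE => /andP[].
have fBt : f \notin Bt by apply: contra fB; apply: (subsetP BtB).
have MK0 : K :\ f \in indep M by apply: indep_sub MK _; exact: subsetDl.
have [/existsP[g /and3P[gBt gK MgK]]|/existsPn noswap] :=
  boolP [exists g, [&& g \in Bt, g \notin K :\ f & g |: K :\ f \in indep M]].
  exists (g |: K :\ f) => //; split; first exact: subsetUr.
  rewrite big_setU1 //= -sumD1 // lerD2r.
  by move: gBt; rewrite inE => /andP[].
(* No element of [Bt] extends K - f, so K - f spans [Bt]; as f lies outside that
   span, [Bt] + f is independent and completes to a base missing at most one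
   element of B, of weight below [t]: a base through f that is too heavy. *)
exfalso.
set T := (K :\ f) :|: Bt.
have rT : rank M T = #|K :\ f|.
  have [Y MY [KY YT cY]] := indep_extend MK0 (subsetUl (K :\ f) Bt).
  rewrite -cY; suff -> : Y = K :\ f by [].
  apply/eqP; rewrite eqEsubset KY andbT; apply/subsetP => g gY; apply: contraT => gK.
  have gBt : g \in Bt.
    by have := subsetP YT _ gY; rewrite in_setU (negPf gK).
  have := noswap g; rewrite gBt gK /= => /negP[].
  by apply: indep_sub MY _; rewrite subUset sub1set gY.
have MBt : Bt \in indep M by apply: indep_sub MB BtB.
have [X MX [BtX XT cX]] := indep_extend MBt (subsetUr (K :\ f) Bt).
have ltX : (#|X| < #|K|)%N by rewrite cX -/T rT (cardsD1 f K) fK.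
have [e /setDP[eK eX] MeX] := indep_aug MX MK ltX.
have ef : e = f.
  apply/eqP; apply: contraT => nef.
  have eT : e |: X \subset T by rewrite subUset sub1set XT /T in_setU in_setD1 nef eK.
  by have := card_le_rank MeX eT; rewrite cardsU1 eX cX -/T add1n ltnn.
have MfBt : f |: Bt \in indep M.
  by apply: indep_sub MeX _; rewrite ef setUS.
have [|Z MZ [BtZ ZB cZ]] := @indep_extend _ M (f |: Bt) (f |: B) MfBt.
  exact: setUS.
have fZ : f \in Z by apply: (subsetP BtZ); rewrite setU11.
have ZBsub : Z :\ f \subset B.
  apply/subsetP => g; rewrite in_setD1 => /andP[gf /(subsetP ZB)].
  by rewrite in_setU1 (negPf gf).
have cBZ : (#|B :\: Z| <= 1)%N.
  have leBZ : (#|B| <= #|Z|)%N.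
    by rewrite cZ; apply: card_le_rank => //; exact: subsetUr.
  have -> : B :\: Z = B :\: (Z :\ f).
    apply/setP => g; rewrite !inE negb_and negbK.
    by case: (eqVneq g f) => [->|//]; rewrite (negPf fB) !andbF.
  rewrite cardsDS // leq_subLR addn1.
  by move: leBZ; rewrite (cardsD1 f Z) fZ.
have ltBZ : \sum_(e in B :\: Z) s e < t.
  have [->|[g gBZ]] := set_0Vmem (B :\: Z); first by rewrite big_set0.
  have -> : B :\: Z = [set g].
    by apply/eqP; rewrite eq_sym eqEcard sub1set gBZ cards1.
  rewrite big_set1 ltNge; apply: contraL gBZ => tg.
  rewrite in_setD; apply/negP => /andP[/negP gZ gB]; apply: gZ.
  by apply: (subsetP BtZ); rewrite in_setU1 inE gB tg orbT.
have := maxBf Z MZ fZ; rewrite sumD1 //.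
have : \sum_(e in B) s e = \sum_(e in Z :\ f) s e + \sum_(e in B :\: Z) s e.
  rewrite (big_setID Z) /=; congr (_ + _); apply: eq_bigl => g.
  rewrite !inE; case: (eqVneq g f) => [->|gf] /=; first by rewrite (negPf fB).
  apply: andb_idl => gZ; apply: (subsetP ZBsub); by rewrite in_setD1 gf.
move: ltBZ; rewrite optB /t; lra.
Qed.

End EntryPrice.

(** * Atoms of the tight sets *)

Section Atoms.
Variables (R : realFieldType) (E : finType) (M : matroid E) (z : E -> R).
Hypothesis z_ge0 : forall e, 0 <= z e.
Hypothesis z_le : forall S : {set E}, \sum_(e in S) z e <= (rank M S)%:R.
Implicit Types (S T : {set E}).

Definition tight S := \sum_(e in S) z e == (rank M S)%:R.

Lemma sum_setUI S T : \sum_(e in S :|: T) z e + \sum_(e in S :&: T) z e =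
  \sum_(e in S) z e + \sum_(e in T) z e.
Proof.
rewrite (big_setID S) /= (setIidPr (subsetUl S T)) setDUl setDv set0U -addrA.
congr (_ + _).
by rewrite [RHS](big_setID S) /= addrC setIC.
Qed.

Lemma tightUI S T : tight S -> tight T -> tight (S :|: T) /\ tight (S :&: T).
Proof.
move=> /eqP tS /eqP tT; have := rank_submod M S T.
rewrite -(ler_nat R) !natrD -tS -tT -sum_setUI => le.
have := z_le (S :|: T); have := z_le (S :&: T) => leI leU.
by split; apply/eqP; lra.
Qed.

(** The elements of the support that no tight set separates from [e]. *)
Definition atom e := [set e' | (z e' != 0) &&
  [forall S, tight S ==> ((e \in S) == (e' \in S))]].

Lemma atom_refl e : z e != 0 -> e \in atom e.
Proof. by move=> ze; rewrite inE ze; apply/forallP => S; rewrite eqxx implybT. Qed.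

Lemma atom_supp e e' : e' \in atom e -> z e' != 0.
Proof. by rewrite inE => /andP[]. Qed.

Lemma atom_tight e e' S : e' \in atom e -> tight S -> (e' \in S) = (e \in S).
Proof.
by rewrite inE => /andP[_ /forallP/(_ S)/implyP h] /h /eqP ->.
Qed.

Lemma atom_eq e e' : e' \in atom e -> atom e' = atom e.
Proof.
move=> e'e; apply/setP => a; rewrite !inE; congr (_ && _).
apply: eq_forallb => S; case tS: (tight S) => //=.
by rewrite (atom_tight e'e tS).
Qed.

(** A tight set is, up to elements of value 0, a disjoint union of atoms. *)
Lemma sum_tight_eq0 (d : E -> R) S : tight S ->
    (forall e, z e = 0 -> d e = 0) ->
    (forall e, e \in S -> z e != 0 -> \sum_(a in atom e) d a = 0) ->
  \sum_(e in S) d e = 0.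
Proof.
move=> tS d0 dat.
have -> : \sum_(e in S) d e = \sum_(e in S | z e != 0) d e.
  rewrite (bigID (fun e => z e != 0)) /= [X in _ + X]big1 ?addr0 //.
  by move=> e /andP[_]; rewrite negbK => /eqP /d0.
rewrite (partition_big atom xpredT) //= big1 // => D _.
have [/existsP[e /and3P[eS ze /eqP <-]]|/existsPn no] :=
  boolP [exists e, [&& e \in S, z e != 0 & atom e == D]].
  rewrite -[RHS](dat e eS ze); apply: eq_bigl => a; apply/andP/idP.
    by case=> /andP[_ za] /eqP <-; exact: atom_refl.
  by move=> ae; rewrite (atom_tight ae tS) eS (atom_supp ae) (atom_eq ae).
by rewrite big_pred0 // => e; apply/negbTE; rewrite -andbA; exact: no.
Qed.

(** The atom of [e] is, up to elements of value 0, the difference of two tight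
    sets: the least one containing [e], and the greatest one within it that
    avoids [e].  So its mass is a positive integer. *)
Lemma atom_mass e S : tight S -> e \in S -> z e != 0 ->
  1 <= \sum_(a in atom e) z a.
Proof.
move=> tS eS ze.
have P0 : tight S && (e \in S) by rewrite tS.
case: (@arg_minnP {set E} S (fun S => tight S && (e \in S)) (fun S => #|S|) P0).
move=> C /andP[tC eC] minC {P0}.
have CS T : tight T -> e \in T -> C \subset T.
  move=> tT eT; apply/setIidPl/eqP; rewrite eqEcard subsetIl /=.
  by apply: minC; rewrite (tightUI tC tT).2 inE eC.
have t0 : tight set0 by rewrite /tight big_set0 rank0.
have Q0 : tight set0 && (e \notin set0) by rewrite t0 inE.
case: (@arg_maxnP {set E} set0 (fun S => tight S && (e \notin S)) (fun S => #|S|) Q0).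
move=> U /andP[tU eU] maxU {Q0}.
have US T : tight T -> e \notin T -> T \subset U.
  move=> tT eT; apply/setUidPl/eqP; rewrite eq_sym eqEcard subsetUl /=.
  by apply: maxU; rewrite (tightUI tU tT).1 inE negb_or eU.
have atomE a : (a \in atom e) = [&& a \in C :\: U & z a != 0].
  apply/idP/andP => [ae|[/setDP[aC aU] za]].
    by rewrite (atom_supp ae) in_setD !(atom_tight ae) // eU eC.
  rewrite inE za; apply/forallP => T; apply/implyP => tT.
  have [eT|eT] := boolP (e \in T); first by rewrite (subsetP (CS _ tT eT)).
  by apply/eqP/esym/negbTE; apply: contra aU; exact: (subsetP (US _ tT eT)).
have -> : \sum_(a in atom e) z a = \sum_(a in C :\: U) z a.
  rewrite [RHS](bigID (fun e => z e != 0)) /= [X in _ = _ + X]big1 ?addr0.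
    by apply: eq_bigl => a; rewrite atomE.
  by move=> a /andP[_]; rewrite negbK => /eqP.
have /eqP tUC := (tightUI tC tU).2; move/eqP: (tC).
rewrite (big_setID U) /= tUC => /(canRL (addKr _)) sumE.
have : 0 < \sum_(a in C :\: U) z a.
  rewrite (big_setD1 e) /=; last by rewrite inE eU.
  by rewrite ltr_wpDr ?sumr_ge0 // lt0r ze z_ge0.
by rewrite sumE addrC subr_gt0 ltr_nat lerBrDr nat1r ler_nat.
Qed.

End Atoms.

(** * Improving a fractional point *)

Lemma sparse_solution (R : realFieldType) (E T : finType) (F : {set E})
    (A : {set T}) (D : T -> {set E}) : (#|A| < #|F|)%N ->
  exists d : E -> R, [/\ forall e, e \notin F -> d e = 0, exists e, d e != 0
    & forall a, a \in A -> \sum_(e in D a) d e = 0].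
Proof.
move=> AF.
pose Q : 'M[R]_(#|F|, #|A|) := \matrix_(i, j) (enum_val i \in D (enum_val j))%:R.
have /rowV0Pn [v /sub_kermxP vQ v0] : kermx Q != 0.
  rewrite -mxrank_eq0 mxrank_ker -lt0n subn_gt0.
  exact: leq_ltn_trans (rank_leq_col Q) AF.
pose d e := if insub e : {? e | e \in F} is Some u
  then v 0 (enum_rank_in (valP u) (val u)) else 0.
have dE i : d (enum_val i) = v 0 i.
  rewrite /d insubT; first exact: enum_valP.
  by move=> iF /=; rewrite enum_valK_in.
have dN e : e \notin F -> d e = 0 by move=> eF; rewrite /d insubF // (negPf eF).
exists d; split=> //.
  have [i vi] : exists i, v 0 i != 0 by apply/rV0Pn.
  by exists (enum_val i); rewrite dE.
move=> a aA.
have := congr1 (fun N : 'rV_#|A| => N 0 (enum_rank_in aA a)) vQ.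
rewrite !mxE => vQa; rewrite -[RHS]vQa.
rewrite (bigID (mem F)) /= [X in _ + X]big1 ?addr0; last by move=> e /andP[_ /dN].
have -> : \sum_(e in D a | e \in F) d e = \sum_(e in F) (e \in D a)%:R * d e.
  rewrite big_andbC big_mkcondr; apply: eq_bigr => e _.
  by case: (e \in D a); rewrite ?mul1r ?mul0r.
rewrite [LHS]big_enum_val /=; apply: eq_bigr => i _.
by rewrite dE !mxE enum_rankK_in // mulrC.
Qed.

(** The ratio test of linear programming, with slacks [a] and rates [b]. *)
Lemma ratio_test (R : realFieldType) (T : finType) (a b : T -> R) :
    (forall i, 0 <= a i) -> (forall i, a i = 0 -> b i = 0) ->
    (exists i, b i < 0) ->
  exists2 t : R, 0 < t & (forall i, 0 <= a i + t * b i) /\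
    exists2 i, a i != 0 & a i + t * b i = 0.
Proof.
move=> a0 ab [i0 bi0].
case: (@arg_minP _ R T i0 (fun i => b i < 0) (fun i => a i / - b i) bi0) => i bi mini.
have ai : 0 < a i.
  by rewrite lt0r a0 andbT; apply/eqP => /ab bi_0; rewrite bi_0 ltxx in bi.
have t0 : 0 < a i / - b i by rewrite divr_gt0 // oppr_gt0.
exists (a i / - b i) => //; split=> [k|].
  have [bk|bk] := ltrP (b k) 0; last by rewrite addr_ge0 // mulr_ge0 // ltW.
  have := mini k bk; rewrite ler_pdivlMr ?oppr_gt0 //; lra.
exists i; first by rewrite gt_eqF.
by rewrite invrN mulrN mulNr divfK ?subrr // lt_eqF.
Qed.

Section Relaxation.
Variables (R : realFieldType) (E : finType) (m p : nat) (M : 'I_m -> matroid E).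
Hypothesis cover : forall e, exists j, e \in ground (M j).
Hypothesis degree : forall e, (#|[set j | e \in ground (M j)]| <= p)%N.
Implicit Types (F S D : {set E}) (x w d : E -> R) (z s : 'I_m -> E -> R).

(** The LP in which only the elements of [F] need the same value [x e] in all the
    matroids containing them; any other element is split into one independent
    copy per matroid, the copy of [e] in [M j] having value [z j e]. *)
Definition relax_point F x z : Prop :=
  [/\ forall j e, 0 <= z j e,
      forall j S, \sum_(e in S) z j e <= (rank (M j) S)%:R
    & forall j e, e \in F -> e \in ground (M j) -> z j e = x e].

Definition relax_value F w s x z : R :=
  \sum_(e in F) w e * x e + \sum_j \sum_e s j e * z j e.

Lemma relax_valueD F w s x z d c t :
  relax_value F w s (fun e => x e + t * d e) (fun j e => z j e + t * c j e) =
  relax_value F w s x z + t * relax_value F w s d c.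
Proof.
rewrite /relax_value mulrDr addrACA !mulr_sumr -!big_split /=; congr (_ + _).
  by apply: eq_bigr => e _; rewrite mulrDr mulrCA.
apply: eq_bigr => j _; rewrite mulr_sumr -big_split /=.
by apply: eq_bigr => e _; rewrite mulrDr mulrCA.
Qed.

Definition slack z (i : ('I_m * E) + ('I_m * {set E})) : R :=
  match i with
  | inl (j, e) => z j e
  | inr (j, X) => (rank (M j) X)%:R - \sum_(e in X) z j e
  end.

Definition active z := [set i | slack z i == 0].

Lemma supp_ground F x z j e : relax_point F x z -> z j e != 0 -> e \in ground (M j).
Proof.
move=> [z0 zr _]; apply: contraNT => eg.
have [I MI [Ie cI]] := rank_witness (M j) [set e].
have I0 : I = set0.
  apply/setP => a; rewrite in_set0; apply/negP => aI.
  have /set1P ae := subsetP Ie _ aI; rewrite ae in aI.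
  by rewrite (subsetP (indep_ground MI)) in eg.
have := zr j [set e]; rewrite big_set1 -cI I0 cards0 => le0.
by rewrite eq_le le0 z0.
Qed.

(** A direction that keeps every active constraint active can be followed, in
    whichever sense does not decrease the objective, until a further constraint
    becomes active. *)
Lemma follow_direction F w s x z d c :
    relax_point F x z ->
    (forall j e, e \in F -> e \in ground (M j) -> c j e = d e) ->
    (forall j e, z j e = 0 -> c j e = 0) ->
    (forall j S, tight (M j) (z j) S -> \sum_(e in S) c j e = 0) ->
    (exists2 e, e \in F & d e != 0) ->
  exists x' z', [/\ relax_point F x' z',
    relax_value F w s x z <= relax_value F w s x' z'
    & (#|active z| < #|active z'|)%N].
Proof.
move=> zP; wlog v0 : d c / 0 <= relax_value F w s d c.
  move=> hw cd c0 ct [e eF de].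
  have [/hw|/ltW v0] := lerP 0 (relax_value F w s d c).
    by apply => //; exists e.
  apply: (hw (fun e => - d e) (fun j e => - c j e)).
  - suff -> : relax_value F w s (fun e => - d e) (fun j e => - c j e) =
      - relax_value F w s d c by rewrite oppr_ge0.
    rewrite /relax_value opprD -!sumrN; congr (_ + _); apply: eq_bigr => a _.
      by rewrite mulrN.
    by rewrite -sumrN; apply: eq_bigr => b _; rewrite mulrN.
  - by move=> j a aF aj; rewrite cd.
  - by move=> j a /c0 ->; rewrite oppr0.
  - by move=> j S /ct; rewrite sumrN => ->; rewrite oppr0.
  - by exists e => //; rewrite oppr_eq0.
move=> cd c0 ct [e eF de]; have [z0 zr zx] := zP.
pose b (i : ('I_m * E) + ('I_m * {set E})) :=
  match i with inl (j, e) => c j e | inr (j, X) => - \sum_(e in X) c j e end.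
have slack_ge0 i : 0 <= slack z i.
  by case: i => [[j a]|[j S]] /=; [exact: z0|rewrite subr_ge0; exact: zr].
have slack_b i : slack z i = 0 -> b i = 0.
  case: i => [[j a]|[j S]] /=; first exact: c0.
  by move=> /subr0_eq tS; rewrite ct ?oppr0 // /tight tS.
have [j ej] := cover e.
have [|t t0 [tP [i zi0 zi]]] := ratio_test slack_ge0 slack_b.
  have cje := cd j e eF ej.
  have [de0|de0] := ltrP (d e) 0; first by exists (inl (j, e)); rewrite /= cje.
  by exists (inr (j, [set e])); rewrite /= big_set1 cje oppr_lt0 lt0r de.
pose x' a := x a + t * d a; pose z' k a := z k a + t * c k a.
have slack' k : slack z' k = slack z k + t * b k.
  case: k => [[k a]|[k S]] //=.
  by rewrite big_split /= -mulr_sumr opprD mulrN addrA.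
exists x', z'; split.
- split=> [k a|k S|k a aF ak].
  + by have := tP (inl (k, a)); rewrite -slack'.
  + by have := tP (inr (k, S)); rewrite -slack' /= subr_ge0.
  + by rewrite /z' zx // cd.
- by rewrite relax_valueD lerDl mulr_ge0 // ltW.
- apply: proper_card; apply/properP; split; last first.
    by exists i; rewrite inE ?slack' ?zi.
  apply/subsetP => k; rewrite !inE slack' => /eqP k0.
  by rewrite k0 slack_b // mulr0 addr0.
Qed.

(** Only the atoms inside [F] that lie in a tight set hinder moving the values on
    [F]: in any other atom of a tight set, the elements outside [F] absorb the
    change, their values not being tied together.  These atoms have mass at least
    1, hence more than [p] elements when all values are below [1/p]; as each
    element of [F] lies in at most [p] of them, they are fewer than the elements
    of [F]. *)
Lemma improvable F w s x z :
    relax_point F x z -> F != set0 ->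
    (forall e, e \in F -> x e != 0 /\ x e < p%:R^-1) ->
  exists x' z', [/\ relax_point F x' z',
    relax_value F w s x z <= relax_value F w s x' z'
    & (#|active z| < #|active z'|)%N].
Proof.
move=> zP F0 xF; have [z0 zr zx] := zP.
have p0 : (0 < p)%N.
  have /set0Pn[e eF] := F0; have [j ej] := cover e.
  by apply: leq_trans (degree e); apply/card_gt0P; exists j; rewrite inE.
pose at_ j := atom (M j) (z j).
pose A := [set a : 'I_m * {set E} | [exists e, [&& e \in F, e \in ground (M a.1),
  a.2 == at_ a.1 e, a.2 \subset F & [exists S, tight (M a.1) (z a.1) S && (e \in S)]]]].
have suppF j e : e \in F -> e \in ground (M j) -> z j e != 0.
  by move=> eF ej; rewrite zx //; case: (xF e eF).
have cardA : (#|A| < #|F|)%N.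
  rewrite ltnNge; apply/negP => FA.
  have big_atom a : a \in A -> (p.+1 <= #|a.2|)%N.
    case: a => j D; rewrite inE /= => /existsP[e].
    case/and5P=> eF ej /eqP De DF /existsP[S /andP[tS eS]].
    have := atom_mass (z0 j) (zr j) tS eS (suppF j e eF ej).
    rewrite -/(at_ j) -De => le1.
    rewrite -(ltr_nat R) -[ltLHS]mul1r -ltr_pdivlMr ?ltr0n //.
    apply: le_lt_trans le1 _.
    rewrite -sum1_card natr_sum mulr_suml; apply: ltr_sum.
      apply/hasP; exists e; first exact: mem_index_enum.
      by rewrite De; exact: atom_refl (suppF j e eF ej).
    move=> a aD; rewrite mul1r zx ?(subsetP DF) //.
      by case: (xF a); rewrite ?(subsetP DF).
    by apply: supp_ground zP _; apply: (@atom_supp _ _ (M j) _ e); rewrite -/(at_ j) -De.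
  have count : (\sum_(a in A) #|a.2| <= p * #|F|)%N.
    have -> : (\sum_(a in A) #|a.2| = \sum_(e in F) #|[set a in A | e \in a.2]|)%N.
      rewrite [RHS](eq_bigr (fun e => \sum_(a in A) (e \in a.2 : nat))); last first.
        move=> e _; rewrite -sum1dep_card big_mkcondr.
        by apply: eq_bigr => a _; case: (e \in a.2).
      rewrite exchange_big /=; apply: eq_bigr => a aA.
      rewrite -sum1_card (eq_bigl (fun e => (e \in F) && (e \in a.2))); last first.
        move=> e; apply/esym/andb_idl; move: e; apply/subsetP.
        by move: aA; rewrite inE => /existsP[? /and5P[]].
      by rewrite big_mkcondr; apply: eq_bigr => e _; case: (e \in a.2).
    rewrite mulnC -sum_nat_const; apply: leq_sum => e eF.
    apply: leq_trans (degree e).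
    rewrite -[leqRHS](card_imset _ (can_inj (_ : cancel (fun j => (j, at_ j e)) fst))) //.
    apply: subset_leq_card; apply/subsetP => -[j D]; rewrite 2!inE /=.
    case/andP=> /existsP[a /and5P[aF aj /eqP De DF _]] eD.
    apply/imsetP; exists j; last by rewrite De /at_ (atom_eq (e := a)) // -/(at_ j) -De.
    rewrite inE; apply: supp_ground zP _.
    by apply: (@atom_supp _ _ (M j) _ a); rewrite -/(at_ j) -De.
  have : (p.+1 * #|A| <= p * #|F|)%N.
    by apply: leq_trans count; rewrite mulnC -sum_nat_const; exact: leq_sum.
  rewrite leqNgt => /negP[]; apply: (@leq_trans (p.+1 * #|F|));
    last by rewrite leq_mul2l FA orbT.
  by rewrite ltn_mul2r ltnSn andbT card_gt0.
have [d [dN [e0 de0] dA]] := @sparse_solution R E _ F A snd cardA.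
(* Outside [F] the sum of [d] over the atom is spread with the opposite sign. *)
pose c j e := if e \in F then (if e \in ground (M j) then d e else 0)
  else if z j e == 0 then 0
  else - (\sum_(a in at_ j e | a \in F) d a) / #|at_ j e :\: F|%:R.
apply: (@follow_direction F w s x z d c zP).
- by move=> j e eF ej; rewrite /c eF ej.
- move=> j e ze; rewrite /c ze eqxx; case: ifP => // eF; case: ifP => // ej.
  by have := suppF j e eF ej; rewrite ze eqxx.
- move=> j S tS; apply: (sum_tight_eq0 tS).
    move=> e ze; rewrite /c ze eqxx; case: ifP => // eF; case: ifP => // ej.
    by have := suppF j e eF ej; rewrite ze eqxx.
  move=> e eS ze.
  have inF a : a \in at_ j e -> a \in F -> c j a = d a.
    move=> ae aF; rewrite /c aF (supp_ground zP) //; exact: atom_supp ae.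
  rewrite -/(at_ j e) (bigID (mem F)) /=.
  rewrite (eq_bigr d); last by move=> a /andP[ae aF]; rewrite inF.
  have [sub|/subsetPn[g ge gF]] := boolP (at_ j e \subset F).
    rewrite [X in _ + X]big_pred0 ?addr0; last first.
      move=> a; apply/negbTE; rewrite negb_and negbK.
      by case: (boolP (a \in _)) => //= /(subsetP sub).
    rewrite -[RHS](dA (j, at_ j e)); last first.
      rewrite inE /=; apply/existsP; exists e.
      rewrite (subsetP sub) ?atom_refl // (supp_ground zP) // eqxx sub /=.
      by apply/existsP; exists S; rewrite tS eS.
    apply: eq_bigl => a /=; rewrite andb_idr //; exact: (subsetP sub).
  set u := \sum_(a in _ | _) _.
  rewrite (eq_bigr (fun _ => - u / #|at_ j e :\: F|%:R)); last first.
    move=> a /andP[ae aF]; rewrite /c (negPf aF) (negPf (atom_supp ae)).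
    by rewrite /at_ (atom_eq ae).
  rewrite (eq_bigl (mem (at_ j e :\: F))); last by move=> a; rewrite !inE andbC.
  rewrite sumr_const -[X in u + X]mulr_natr divfK ?addrN //.
  by rewrite pnatr_eq0 -lt0n; apply/card_gt0P; exists g; rewrite in_setD gF.
- by exists e0 => //; apply: contraNT de0 => /dN ->.
Qed.

(** Repeated improvement ends, as the number of active constraints grows. *)
Lemma sparse_point F w s x z : relax_point F x z -> F != set0 ->
  exists x' z', [/\ relax_point F x' z',
    relax_value F w s x z <= relax_value F w s x' z'
    & exists2 e, e \in F & x' e = 0 \/ p%:R^-1 <= x' e].
Proof.
move=> zP F0; have [n] := ubnP (#|{: ('I_m * E) + ('I_m * {set E})}| - #|active z|)%N.
elim: n x z zP => // n IHn x z zP ltn.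
have [/existsP[e /andP[eF xe]]|/existsPn none] :=
  boolP [exists e, (e \in F) && ((x e == 0) || (p%:R^-1 <= x e))].
  by exists x, z; split=> //; exists e => //; case/orP: xe => [/eqP|]; [left|right].
have [|x1 [z1 [zP1 v1 a1]]] := @improvable F w s x z zP F0.
  move=> e eF; have := none e; rewrite eF /= negb_or -ltNge => /andP[] //.
have [|x' [z' [zP' v' ex']]] := IHn x1 z1 zP1.
  rewrite -ltnS; apply: leq_trans ltn; rewrite ltnS ltn_sub2l //.
  by apply: leq_trans a1 (max_card _).
by exists x', z'; split=> //; exact: le_trans v1 v'.
Qed.

End Relaxation.

(** * Rounding *)

Definition gap (R : realFieldType) (p : nat) : R := p%:R - 1 + p%:R^-1.
Arguments gap R p : clear implicits.

Lemma gap_ge1 (R : realFieldType) (p : nat) : (0 < p)%N -> 1 <= gap R p.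
Proof.
rewrite /gap; case: p => [|[|p]] // _; first by rewrite invr1 subrr add0r.
have : 2 <= p.+2%:R :> R by rewrite ler_nat.
have : 0 <= p.+2%:R^-1 :> R by rewrite invr_ge0 ler0n.
by move: (p.+2%:R) (p.+2%:R^-1) => a b; lra.
Qed.

(** The balance of the rounding step: privatising an element of value [xf], that
    lies in [q] matroids and whose weight [wf] exceeds its prices by [W], loses
    at most [q - 1] times [W], and the right hand side makes up for that.  In the
    extremal case [wf = T + W], [xf = 1/p], the difference of the two sides is a
    positive multiple of [(p - q) * (1 - 1/p) * W]. *)
Lemma privatise_balance (R : realFieldType) (p q : nat) (wf xf T W : R) :
    (0 < q <= p)%N -> 0 <= W -> wf <= T + W -> p%:R^-1 <= xf ->
  (q%:R - 1) * W <=
    xf * (T + q%:R * W - wf) / gap R p + (1 - (gap R p)^-1) * (q%:R * W).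
Proof.
move=> /andP[q0 qp] W0 wfW xp.
have p0 : (0 < p)%N by exact: leq_trans qp.
have a0 : 0 < gap R p by apply: lt_le_trans (gap_ge1 R p0).
have q1 : 1 <= q%:R :> R by rewrite ler1n.
have qpR : q%:R <= p%:R :> R by rewrite ler_nat.
have pR0 : p%:R != 0 :> R by rewrite pnatr_eq0 -lt0n.
have le1 : p%:R^-1 * ((q%:R - 1) * W) <= xf * (T + q%:R * W - wf).
  have pi0 : 0 <= p%:R^-1 :> R by rewrite invr_ge0.
  have qW : 0 <= (q%:R - 1) * W by rewrite mulr_ge0 // subr_ge0.
  apply: le_trans (ler_wpM2r qW xp) _; rewrite ler_wpM2l //; first exact: le_trans xp.
  by lra.
have i1 : p%:R^-1 <= 1 :> R by rewrite invf_le1 ?ltr0n // ler1n.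
have nn : 0 <= (p%:R - q%:R) * (1 - p%:R^-1) * W.
  by rewrite !mulr_ge0 // subr_ge0.
rewrite -(ler_pM2r a0).
have -> (b c : R) : (b / gap R p + (1 - (gap R p)^-1) * c) * gap R p =
    b + (gap R p - 1) * c by field; rewrite gt_eqF.
have : (p%:R - q%:R) * (1 - p%:R^-1) * W = p%:R^-1 * ((q%:R - 1) * W)
    + (gap R p - 1) * (q%:R * W) - (q%:R - 1) * W * gap R p.
  by rewrite /gap; field.
lra.
Qed.

Section Rounding.
Variables (R : realFieldType) (E : finType) (m p : nat) (M : 'I_m -> matroid E).
Hypothesis cover : forall e, exists j, e \in ground (M j).
Hypothesis degree : forall e, (#|[set j | e \in ground (M j)]| <= p)%N.

(** A rounding of the relaxed LP chooses elements [I] of [F] once and for all, and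
    in each matroid [M j] a set [K j] around them, whose elements outside [F] are
    paid [s j].  The term in [max_weight] is the reserve from which [rounding_step]
    pays for making a further element private. *)
Definition rounded (F : {set E}) (w x : E -> R) (s z : 'I_m -> E -> R) : Prop :=
  exists (I : {set E}) (K : 'I_m -> {set E}),
    [/\ I \subset F,
        forall j, K j \in indep (M j) /\ I :&: ground (M j) \subset K j
      & relax_value F w s x z / gap R p
          + (1 - (gap R p)^-1) * \sum_j max_weight (M j) (s j)
        <= \sum_(e in I) w e + \sum_j \sum_(e in K j) s j e].

Definition roundable (F : {set E}) : Prop :=
  forall (w x : E -> R) (s z : 'I_m -> E -> R),
    (forall j e, 0 <= s j e) -> (forall j e, e \in F -> s j e = 0) ->
    relax_point M F x z -> rounded F w x s z.

(** [f] is made private, at a price [W] above its entry price [t j] in every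
    matroid [M j] containing it, where [W] is the excess of its weight over the
    sum of these prices.  A rounding for [F :\ f] that puts [f] in all the [K j]
    gives one that puts [f] in [I]; otherwise [f] is sold at its entry price
    wherever it occurs.  Either way at most [q - 1] times [W] is lost, with [q] the
    number of matroids containing [f]. *)
Lemma rounding_step (F : {set E}) (w x : E -> R) (s z : 'I_m -> E -> R) f :
    roundable (F :\ f) ->
    (forall j e, 0 <= s j e) -> (forall j e, e \in F -> s j e = 0) ->
    relax_point M F x z -> f \in F -> p%:R^-1 <= x f ->
  rounded F w x s z.
Proof.
move=> IH s0 sF zP fF xf; have [z0 zr zx] := zP.
pose g j := f \in ground (M j); pose q := #|[set j | g j]|.
have q0 : (0 < q)%N.
  by have [j fj] := cover f; apply/card_gt0P; exists j; rewrite inE.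
have qp : (q <= p)%N by exact: degree.
have p0 : (0 < p)%N by exact: leq_trans qp.
have Mf j : g j -> [set f] \in indep (M j).
  move=> fj; have [I MI [If cI]] := rank_witness (M j) [set f].
  suff -> : [set f] = I by [].
  apply/eqP; rewrite eq_sym eqEcard If cards1 cI -(ltr_nat R).
  apply: lt_le_trans (zr j [set f]); rewrite big_set1 zx //.
  by apply: lt_le_trans xf; rewrite invr_gt0 ltr0n.
have /fin_all_exists[t tP] : forall j, exists t : R, [/\ 0 <= t, ~~ g j -> t = 0,
    g j -> exists2 B, B \in indep (M j) &
      f \in B /\ max_weight (M j) (s j) <= t + \sum_(e in B) s j e
  & forall K, K \in indep (M j) -> f \in K -> exists2 K', K' \in indep (M j) &
      K :\ f \subset K' /\ t + \sum_(e in K) s j e <= \sum_(e in K') s j e].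
  move=> j; have [fj|fj] := boolP (g j).
    by have [t [t0 tB tK]] := entry_price (s0 j) (sF j f fF) (Mf j fj); exists t; split.
  exists 0; split=> // K MK fK; have := subsetP (indep_ground MK) _ fK.
  by move/negP: fj.
pose T := \sum_j t j; pose W := Num.max 0 (w f - T).
have W0 : 0 <= W by rewrite le_max lexx.
have wfW : w f <= T + W by rewrite -lerBlDl le_max lexx orbT.
pose s' j e := if (e == f) && g j then t j + W else s j e.
have sumW : \sum_j (g j)%:R * W = q%:R * W.
  rewrite -mulr_suml /q -sum1dep_card natr_sum [in RHS]big_mkcond; congr (_ * _).
  by apply: eq_bigr => j _; case: (g j).
have sumt : \sum_j (g j)%:R * (t j + W) = T + q%:R * W.
  rewrite -sumW -big_split; apply: eq_bigr => j _ /=.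
  have [_ t0 _ _] := tP j; have [_|/t0 ->] := boolP (g j); first by rewrite !mul1r.
  by rewrite !mul0r addr0.
have s'K j K : K \in indep (M j) ->
    \sum_(e in K) s' j e = \sum_(e in K) s j e + (f \in K)%:R * (t j + W).
  move=> MK; have [fK|fK] := boolP (f \in K).
    have fj : g j by exact: subsetP (indep_ground MK) _ fK.
    rewrite mul1r !(big_setD1 f fK) /= sF // add0r addrC /s' eqxx fj; congr (_ + _).
    by apply: eq_bigr => e /setD1P[/negPf ->].
  rewrite mul0r addr0; apply: eq_bigr => e eK; rewrite /s'.
  by case: eqP => // ef; rewrite -ef eK in fK.
have [|||I [K [IF KP le]]] := IH w x s' z.
- move=> j e; rewrite /s'; case: ifP => // _.
  by rewrite addr_ge0 //; case: (tP j).
- by move=> j e /setD1P[/negPf ef eF]; rewrite /s' ef sF.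
- by split=> // j e /setD1P[_ eF]; exact: zx.
have fI : f \notin I by apply/negP => /(subsetP IF); rewrite setD11.
have IF' : I \subset F by apply: subset_trans IF (subD1set _ _).
have mw : \sum_j max_weight (M j) (s j) + q%:R * W
    <= \sum_j max_weight (M j) (s' j).
  rewrite -sumW -big_split; apply: ler_sum => j _ /=.
  have [_ _ tB _] := tP j; have [fj|fj] := boolP (g j).
    have [B MB [fB leB]] := tB fj; rewrite mul1r.
    apply: le_trans (le_max_weight (s' j) MB); rewrite s'K // fB mul1r.
    by rewrite addrA lerD2r addrC.
  have [B MB <-] := max_weight_attained (M j) (s0 j); rewrite mul0r addr0.
  apply: le_trans (le_max_weight (s' j) MB); rewrite s'K //.
  rewrite lerDl mulr_ge0 // addr_ge0 //; by case: (tP j).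
have rv : relax_value (F :\ f) w s' x z =
    relax_value F w s x z + x f * (T + q%:R * W - w f).
  rewrite /relax_value [in RHS](big_setD1 f) //= -sumt.
  have -> : \sum_j \sum_e s' j e * z j e = \sum_j \sum_e s j e * z j e +
      x f * \sum_j (g j)%:R * (t j + W).
    rewrite mulr_sumr -big_split; apply: eq_bigr => j _ /=.
    rewrite (bigD1 f) //= [in RHS](bigD1 f) //= sF // mul0r add0r /s' eqxx addrC.
    congr (_ + _); first by apply: eq_bigr => e /negPf ->.
    have [fj|fj] /= := boolP (g j); first by rewrite zx // mul1r mulrC.
    by rewrite sF // !mul0r mulr0.
  by ring.
have key (I' : {set E}) (K' : 'I_m -> {set E}) :
    \sum_(e in I) w e + \sum_j \sum_(e in K j) s' j e - (q%:R - 1) * W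
      <= \sum_(e in I') w e + \sum_j \sum_(e in K' j) s j e ->
    relax_value F w s x z / gap R p
      + (1 - (gap R p)^-1) * \sum_j max_weight (M j) (s j)
      <= \sum_(e in I') w e + \sum_j \sum_(e in K' j) s j e.
  apply: le_trans; rewrite lerBrDr; apply: le_trans le; rewrite rv.
  have q_p : (0 < q <= p)%N by rewrite q0.
  have := privatise_balance q_p W0 wfW xf.
  have a1 : 0 <= 1 - (gap R p)^-1.
    by rewrite subr_ge0 invf_le1 ?gap_ge1 // (lt_le_trans _ (gap_ge1 R p0)).
  have := ler_wpM2l a1 mw; rewrite mulrDr mulrDl; lra.
have sumK : \sum_j \sum_(e in K j) s' j e =
    \sum_j \sum_(e in K j) s j e + \sum_j (f \in K j)%:R * (t j + W).
  by rewrite -big_split; apply: eq_bigr => j _; rewrite s'K //; case: (KP j).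
have gK j : f \in K j -> g j.
  by apply: subsetP; apply: indep_ground; case: (KP j).
(* When [W = 0], the weight of [f] may be below the sum [T] of its entry prices,
   so [f] is sold even if every [K j] contains it. *)
have [/andP[Wpos /forallP allK]|notall] :=
  boolP ((0 < W) && [forall j, g j ==> (f \in K j)]).
  exists (f |: I), K; split.
  - by rewrite subUset sub1set fF.
  - move=> j; have [MK IK] := KP j; split=> //.
    rewrite setIUl subUset IK andbT; apply/subsetP => e /setIP[/set1P -> fj].
    by have := allK j; rewrite /g fj.
  apply: key; rewrite big_setU1 //= sumK.
  have -> : \sum_j (f \in K j)%:R * (t j + W) = T + q%:R * W.
    rewrite -sumt; apply: eq_bigr => j _; congr ((nat_of_bool _)%:R * _).
    by apply/idP/idP => [/gK|]; last exact: (implyP (allK j)).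
  have wfE : w f = T + W.
    by move: Wpos; rewrite /W lt_max ltxx /= => lt0; rewrite max_r ?ltW // addrC subrK.
  by rewrite wfE; lra.
have /fin_all_exists[K' K'P] : forall j, exists K' : {set E},
    [/\ K' \in indep (M j), I :&: ground (M j) \subset K' &
     \sum_(e in K j) s j e + (f \in K j)%:R * t j <= \sum_(e in K' ) s j e].
  move=> j; have [MK IK] := KP j; have [fK|fK] := boolP (f \in K j); last first.
    by exists (K j); rewrite mul0r addr0.
  have [_ _ _ /(_ _ MK fK)[K' MK' [KK' leK']]] := tP j.
  exists K'; rewrite mul1r addrC; split=> //.
  apply: subset_trans KK'; rewrite subsetD1 IK /=.
  by rewrite inE (negPf fI).
exists I, K'; split=> // [j|]; first by case: (K'P j).
apply: key.
have leK' : \sum_j \sum_(e in K j) s j e + \sum_j (f \in K j)%:R * t j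
    <= \sum_j \sum_(e in K' j) s j e.
  by rewrite -big_split; apply: ler_sum => j _; case: (K'P j).
have leW : \sum_j (f \in K j)%:R * W <= (q%:R - 1) * W.
  have [->|Wn0] := eqVneq W 0; first by rewrite big1 ?mulr0 // => j _; rewrite mulr0.
  move: notall; rewrite lt0r Wn0 W0 /= => /forallPn[j].
  rewrite negb_imply => /andP[gj fKj].
  rewrite -mulr_suml ler_wpM2r // lerBrDr -natr_sum natr1.
  rewrite ler_nat /q (cardsD1 j) inE gj add1n ltnS -sum1_card [leqRHS]big_mkcond /=.
  apply: leq_sum => k _; case fKk: (f \in K k) => //.
  by rewrite !inE gK // andbT; case: eqP => // kj; rewrite kj (negPf fKj) in fKk.
have sumtW : \sum_j (f \in K j)%:R * (t j + W) =
    \sum_j (f \in K j)%:R * t j + \sum_j (f \in K j)%:R * W.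
  by rewrite -big_split; apply: eq_bigr => j _; rewrite mulrDr.
rewrite sumK sumtW; lra.
Qed.

Lemma rounding (F : {set E}) : (0 < p)%N -> roundable F.
Proof.
move=> p0; have [n] := ubnP #|F|.
elim: n F => // n IHn F ltn w x s z s0 sF zP.
have ai0 : 0 <= (gap R p)^-1 by rewrite invr_ge0 (le_trans ler01) // gap_ge1.
have [F0|F0] := eqVneq F set0.
  have /fin_all_exists[K KP] : forall j, exists K : {set E},
      K \in indep (M j) /\ \sum_(e in K) s j e = max_weight (M j) (s j).
    by move=> j; have [K] := max_weight_attained (M j) (s0 j); exists K.
  exists set0, K; split; first exact: sub0set.
    by move=> j; split; [case: (KP j)|rewrite set0I sub0set].
  rewrite big_set0 add0r [leRHS](eq_bigr (fun j => max_weight (M j) (s j))); last first.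
    by move=> j _; case: (KP j).
  have [z0 zr _] := zP.
  have : relax_value F w s x z <= \sum_j max_weight (M j) (s j).
    rewrite /relax_value F0 big_set0 add0r.
    by apply: ler_sum => j _; exact: matroid_lp_le_max_weight.
  by move/(ler_wpM2r ai0); lra.
have [x' [z' [zP' lev [f fF xf]]]] := sparse_point cover degree w s zP F0.
suff [I [K [IF KP le]]] : rounded F w x' s z'.
  exists I, K; split=> //; apply: le_trans le.
  by rewrite lerD2r ler_wpM2r.
have ltF : (#|F :\ f| < n)%N by rewrite (cardsD1 f) fF in ltn.
case: xf => [xf0|xf]; last first.
  by apply: (@rounding_step F w x' s z' f) => //; exact: IHn.
have [||I [K [IF KP le]]] := IHn (F :\ f) ltF w x' s z' s0.
- by move=> j e /setD1P[_]; exact: sF.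
- have [z0 zr zx] := zP'; split=> // j e /setD1P[_]; exact: zx.
exists I, K; split=> //; first exact: subset_trans IF (subD1set _ _).
by rewrite /relax_value (big_setD1 f) //= xf0 mulr0 add0r.
Qed.

End Rounding.

Lemma matchoid_rounding (R : realFieldType) (p : nat) (E : finType) (m : nat)
    (M : 'I_m -> matroid E) (w x : E -> R) :
    (0 < p)%N -> is_matchoid p M -> (forall e, 0 <= x e) ->
    (forall j (S : {set E}), S \subset ground (M j) ->
       \sum_(e in S) x e <= (rank (M j) S)%:R) ->
  exists2 I, I \in feasible M &
    \sum_e w e * x e <= gap R p * \sum_(e in I) w e.
Proof.
move=> p0 [cov deg] x0 xr.
have cover e : exists j, e \in ground (M j).
  by have := in_setT e; rewrite -cov => /bigcupP[j _ ej]; exists j.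
pose z (j : 'I_m) e := if e \in ground (M j) then x e else 0.
have zP : relax_point M [set: E] x z.
  split=> [j e|j S|j e _ ej]; rewrite /z ?ej //; first by case: ifP.
  rewrite -big_mkcondr.
  rewrite (eq_bigl (mem (S :&: ground (M j)))); last by move=> e; rewrite !inE.
  apply: le_trans (xr j _ (subsetIr _ _)) _.
  by rewrite ler_nat rank_subset // subsetIl.
have a1 := gap_ge1 R p0; have a0 := lt_le_trans ltr01 a1.
have [||I [K [_ KP]]] := rounding cover deg p0 (s := fun _ _ => 0) w _ _ zP => //.
have -> : relax_value [set: E] w (fun _ _ => 0) x z = \sum_e w e * x e.
  rewrite /relax_value [X in _ + X]big1 ?addr0; last first.
    by move=> j _; rewrite big1 // => e _; rewrite mul0r.
  by apply: eq_bigl => e; rewrite inE.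
rewrite [X in _ <= _ + X]big1 ?addr0; last by move=> j _; rewrite big1.
move=> le; exists I.
  rewrite inE; apply/forallP => j; have [MK IK] := KP j.
  exact: indep_sub MK IK.
rewrite mulrC -ler_pdivrMr //; apply: le_trans le; rewrite lerDl mulr_ge0 //.
  by rewrite subr_ge0 invf_le1.
apply: sumr_ge0 => j _.
by apply: le_trans (le_max_weight _ (indep0 (M j))); rewrite big_set0.
Qed.

(** * The matchoid of a projective plane *)

Section UnitMatroid.
Variables (E : finType) (A : {set E}).

Definition unit_indep : {set {set E}} :=
  [set I : {set E} | (I \subset A) && (#|I| <= 1)%N].

Lemma unit_indep_ground (I : {set E}) : I \in unit_indep -> I \subset A.
Proof. by rewrite inE => /andP[]. Qed.

Lemma unit_indep0 : set0 \in unit_indep.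
Proof. by rewrite inE sub0set cards0. Qed.

Lemma unit_indep_sub (I J : {set E}) :
  J \in unit_indep -> I \subset J -> I \in unit_indep.
Proof.
rewrite !inE => /andP[JA J1] IJ; rewrite (subset_trans IJ JA).
exact: leq_trans (subset_leq_card IJ) J1.
Qed.

Lemma unit_indep_aug (I J : {set E}) :
  I \in unit_indep -> J \in unit_indep -> (#|I| < #|J|)%N ->
  exists2 e, e \in J :\: I & e |: I \in unit_indep.
Proof.
rewrite !inE => _ /andP[JA J1] IJ.
have /eqP I0 : I == set0 by rewrite -cards_eq0 -leqn0 -ltnS (leq_trans IJ).
have /card_gt0P[e eJ] : (0 < #|J|)%N by exact: leq_ltn_trans IJ.
exists e; first by rewrite I0 !inE.
by rewrite I0 setU0 inE sub1set (subsetP JA) // cards1.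
Qed.

Definition unit_matroid : matroid E :=
  Matroid unit_indep_ground unit_indep0 unit_indep_sub unit_indep_aug.

Lemma unit_rank_gt0 (S : {set E}) e :
  e \in S -> S \subset A -> (0 < rank unit_matroid S)%N.
Proof.
move=> eS SA; rewrite -(cards1 e); apply: card_le_rank; last by rewrite sub1set.
by rewrite inE sub1set (subsetP SA) // cards1.
Qed.

End UnitMatroid.

Section Plane.
Variables (n : nat) (P L : finType) (inc : P -> L -> bool).
Hypothesis plane : projective_plane n inc.

Definition pencil (j : 'I_#|P|) : {set L} := [set l | inc (enum_val j) l].

Definition plane_matchoid (j : 'I_#|P|) : matroid L := unit_matroid (pencil j).

Lemma card_pencil j : #|pencil j| = n.+1.
Proof. by have [_ h _ _ _] := plane; exact: h. Qed.

Lemma plane_is_matchoid : is_matchoid n.+1 plane_matchoid.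
Proof.
have [_ _ lineP _ _] := plane; split=> [|l].
  apply/setP => l; rewrite inE; apply/bigcupP.
  have /card_gt0P[a] : (0 < #|[set a | inc a l]|)%N by rewrite lineP.
  by rewrite inE => al; exists (enum_rank a); rewrite //= inE enum_rankK.
rewrite -(lineP l) -(card_imset _ (@enum_val_inj P predT)).
apply: subset_leq_card; apply/subsetP => a /imsetP[j].
by rewrite !inE => jl ->.
Qed.

(** Any two lines meet in a point, whose matroid admits only one of them. *)
Lemma plane_feasible_le1 (I : {set L}) : I \in feasible plane_matchoid -> (#|I| <= 1)%N.
Proof.
have [_ _ _ meet _] := plane; rewrite inE => /forallP If.
rewrite leqNgt; apply/negP => /card_gt1P[l1 [l2 [l1I l2I l12]]].
have /card_gt0P[a] : (0 < #|[set a | inc a l1 && inc a l2]|)%N by rewrite meet.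
rewrite inE => /andP[al1 al2]; have := If (enum_rank a).
rewrite inE => /andP[_]; rewrite leqNgt => /negP[].
by apply/card_gt1P; exists l1, l2; rewrite l12 !inE enum_rankK al1 al2 l1I l2I.
Qed.

Lemma plane_feasible1 l : [set l] \in feasible plane_matchoid.
Proof.
rewrite inE; apply/forallP => j; rewrite inE subsetIr /=.
by apply: leq_trans (subset_leq_card (subsetIl _ _)) _; rewrite cards1.
Qed.

Lemma plane_rank (R : realFieldType) j (S : {set L}) : S \subset pencil j ->
  \sum_(l in S) n.+1%:R^-1 <= (rank (plane_matchoid j) S)%:R :> R.
Proof.
move=> Sj; rewrite sumr_const -[X in X <= _]mulr_natl.
have [->|[l lS]] := set_0Vmem S; first by rewrite cards0 mul0r ler0n.
rewrite ler_pdivrMr ?ltr0n // -natrM ler_nat.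
apply: leq_trans (leq_pmull _ (unit_rank_gt0 lS Sj)).
by rewrite -(card_pencil j) subset_leq_card.
Qed.

Lemma plane_gap (R : realFieldType) : #|L|%:R / n.+1%:R = gap R n.+1.
Proof.
have [[_ ->] _ _ _ _] := plane; rewrite /gap.
have n0 : 1 + n%:R != 0 :> R by rewrite nat1r pnatr_eq0.
by rewrite -!natr1 !natrD natrX; field; rewrite addrC.
Qed.

End Plane.

(** * The integrality gap *)

(* The classical sets imported here shadow the finite sets used above. *)
From mathcomp Require Import all_classical all_reals all_analysis.

Lemma lp_opt_le_gap (R : realType) (p : nat) (E : finType) (m : nat)
    (M : 'I_m -> matroid E) (w : E -> R) : (0 < p)%N -> is_matchoid p M ->
  lp_opt M w <= gap R p * int_opt M w.
Proof.
move=> p0 Mp; have [x [x01 Px] [<- _]] := lp_opt_attained M w.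
have [||I If le] := @matchoid_rounding R p E m M w x p0 Mp.
- by move=> e; case/andP: (x01 e).
- by move=> j; case: (Px j).
apply: le_trans le _; rewrite ler_wpM2l //.
  exact: le_trans ler01 (gap_ge1 R p0).
exact: (@le_bigmax_cond _ R _ 0 I (mem (feasible M)) (fun I => \sum_(e in I) w e)).
Qed.

Lemma plane_ratio (R : realType) (n : nat) (P L : finType) (inc : P -> L -> bool) :
  projective_plane n inc -> exists2 r, gap_ratios R n.+1 r & gap R n.+1 <= r.
Proof.
move=> plane; set M := plane_matchoid inc.
have L0 : (0 < #|L|)%N by have [[_ ->] _ _ _ _] := plane; rewrite addn1.
have opt1 : int_opt M (fun _ => 1 : R) = 1.
  apply/eqP; rewrite eq_le; apply/andP; split.
    apply: bigmax_le => // I If.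
    by rewrite sumr_const -[leRHS]/(1%:R) ler_nat (plane_feasible_le1 plane).
  have /card_gt0P[l _] := L0.
  apply: (@bigmax_sup _ R _ 0 [set l]%SET); first exact: plane_feasible1.
  by rewrite big_set1.
exists (lp_opt M (fun _ => 1) / int_opt M (fun _ => 1 : R)).
  exists L, #|P|, M, (fun _ => 1); split=> //; last by rewrite opt1 ltr01.
  exact: plane_is_matchoid.
rewrite opt1 divr1.
have [_ _ [_ lpM]] := lp_opt_attained M (fun _ => 1 : R).
rewrite -(plane_gap plane).
have -> : #|L|%:R / n.+1%:R = \sum_(l : L) 1 * n.+1%:R^-1 :> R.
  by rewrite sumr_const mul1r mulr_natl.
apply: lpM; split=> [l|j]; last split=> [l _|S Sj]; rewrite ?invr_ge0 ?ler0n //.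
  by rewrite /= invf_le1 ?ltr0n // ler1n.
exact: plane_rank.
Qed.

Theorem proposition5p4 (R : realType) (p : nat) (hp : (2 <= p)%N)
    (hplane : exists (P L : finType) (inc : P -> L -> bool),
        projective_plane p.-1 inc) :
  integrality_gap R p = (p%:R - 1 + p%:R^-1)%:E.
Proof.
have p0 : (0 < p)%N by exact: ltnW.
apply/eqP; rewrite eq_le; apply/andP; split.
  apply: ge_ereal_sup => _ [_ [E [m [M [w [Mp w0 opt0 ->]]]]] <-].
  by rewrite lee_fin ler_pdivrMr // -/(gap R p) lp_opt_le_gap.
have [P [L [inc plane]]] := hplane.
have [r] := plane_ratio R plane; rewrite prednK // => rP le.
by apply: le_ereal_sup_tmp; exists r%:E; [exists r|rewrite lee_fin].
Qed.
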